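(* For every integer $n\ge 1$, the map $\theta$ is a bijection between $\mathcal{M}'_n$ and $\mathcal{M}_n$.
   Context: All matrices are square with nonnegative integer entries. $\dim(A)$ is the number of rows of $A$; the weight $w(A)$ is the sum of the entries; rows are numbered from top to bottom and columns from left to right, starting from $1$. For a matrix $A$ whose $j$-th column is nonzero, $\mathrm{rmax}_j(A)$ and $\mathrm{rmin}_j(A)$ are the largest and the smallest index $i$ with $A_{i,j}>0$. For $1\le k\le \dim(A)$, $A[k]$ is the submatrix formed by the first $k$ rows and first $k$ columns of $A$. A Fishburn matrix is an upper triangular matrix with nonnegative integer entries in which every row and every column contains at least one nonzero entry. $\mathcal{M}_n$ is the set of Fishburn matrices of weight $n$ (of any dimension). $\mathcal{M}'_n$ is the set of upper triangular matrices $A$ with nonnegative integer entries (of any dimension) such that: the weight of $A$ is $n$; $A$ has no zero column; and $\mathrm{rmax}_{j+1}(A)>\mathrm{rmin}_j(A)$ for all $1\le j\le\dim(A)-1$. Transformation $\alpha$: let $A$ have $\dim(A)=m$ and $\mathrm{rmax}_m(A)=i$. (1) If $i=m$, then $\alpha(A)=A$. (2) If $i<m$: in $A[m-1]$ insert a new zero row between rows $i-1$ and $i$ and a new zero column between columns $i-1$ and $i$ (so the new row and column have index $i$), obtaining an $m\times m$ matrix $A'$; copy the top $i-1$ entries of the last column of $A'$ into the top $i-1$ entries of the new column $i$, obtaining $A''$; finally replace the top $i$ entries of the last column of $A''$ by the top $i$ entries of the last column of $A$. The result is $\alpha(A)$. For $1\le k\le\dim(A)$, $\alpha_k(A)$ is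 the matrix obtained from $A$ by replacing the submatrix $A[k]$ by $\alpha(A[k])$ and keeping all other entries unchanged. For $A\in\mathcal{M}'_n$ with $\dim(A)=m$, define $\theta(A)=\alpha_m\circ\alpha_{m-1}\circ\cdots\circ\alpha_1(A)$. *)

(* Defs.v *)
From mathcomp Require Import all_boot all_algebra.
From mathcomp Require Import boolp classical_sets functions.

Set Implicit Arguments.
Unset Strict Implicit.
Unset Printing Implicit Defensive.

Local Open Scope classical_set_scope.
Local Open Scope ring_scope.
Local Open Scope nat_scope.

(* Indices are ordinals, so rows and columns are numbered from 0, not from 1. *)

Section FixedDimension.

Variable m : nat.
Implicit Types (A : 'M[nat]_m) (i j : 'I_m).

Definition weight A : nat := \sum_(i < m) \sum_(j < m) A i j.

Definition upper_triangular A : Prop := forall i j, j < i -> A i j = 0.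

Definition no_zero_row A : Prop := forall i, exists j, 0 < A i j.

Definition no_zero_column A : Prop := forall j, exists i, 0 < A i j.

(* If column j is zero, rmax and rmin take the irrelevant value j; otherwise  *)
(* j plays no role as a row index, even when A j j = 0.                       *)
Definition rmax A j : 'I_m := [arg max_(i > j | 0 < A i j) i].

Definition rmin A j : 'I_m := [arg min_(i < j | 0 < A i j) i].

Definition fishburn A : Prop :=
  [/\ upper_triangular A, no_zero_row A & no_zero_column A].

Definition fishburn' A : Prop :=
  [/\ upper_triangular A, no_zero_column A
    & forall j j', j' = j.+1 :> nat -> rmin A j < rmax A j'].

Definition leading_submx (k : nat) (le_km : k <= m) A : 'M[nat]_k :=
  mxsub (widen_ord le_km) (widen_ord le_km) A.

End FixedDimension.

(* unlift i r is None when r = i, and otherwise the index of r once i has     *)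
(* been removed: this inserts a zero row and a zero column, both of index i.  *)
Definition insert_zero p (i : 'I_p.+1) (B : 'M[nat]_p) : 'M[nat]_p.+1 :=
  \matrix_(r, c) match unlift i r, unlift i c with
                 | Some r', Some c' => B r' c'
                 | _, _ => 0
                 end.

Definition alpha p (A : 'M[nat]_p.+1) : 'M[nat]_p.+1 :=
  let i := rmax A ord_max in
  if i == ord_max then A else
  let A' := insert_zero i (leading_submx (leqnSn p) A) in
  let A'' : 'M[nat]_p.+1 :=
    \matrix_(r, c) if (r < i) && (c == i) then A' r ord_max else A' r c in
  \matrix_(r, c) if (r <= i) && (c == ord_max) then A r ord_max else A'' r c.

(* As k is numbered from 0, this acts on the leading block of dimension k.+1: *)
(* it is alpha_(k+1) in 1-based numbering.                                    *)
Definition alpha_at m (k : 'I_m) (A : 'M[nat]_m) : 'M[nat]_m :=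
  let B := alpha (leading_submx (ltn_ord k) A) in
  \matrix_(r, c) if (r <= k) && (c <= k) then B (inord r) (inord c) else A r c.

Definition theta_mx m (A : 'M[nat]_m) : 'M[nat]_m :=
  foldl (fun B k => alpha_at k B) A (enum 'I_m).

Definition sqmx : Type := {m : nat & 'M[nat]_m}.

Definition theta (A : sqmx) : sqmx :=
  existT (fun m => 'M[nat]_m) (projT1 A) (theta_mx (projT2 A)).

Definition Mset (n : nat) : set sqmx :=
  [set A | fishburn (projT2 A) /\ weight (projT2 A) = n].

Definition Mset' (n : nat) : set sqmx :=
  [set A | fishburn' (projT2 A) /\ weight (projT2 A) = n].

(* Main.v *)
(* By induction on the dimension.  For A of dimension p.+1, theta A is alpha   *)
(* applied to the matrix D obtained from A by replacing the leading block of  *)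
(* dimension p by its image under theta, which is Fishburn by induction.  On  *)
(* the matrices with a Fishburn leading block whose last column satisfies the *)
(* rmax/rmin condition, alpha is a bijection onto the Fishburn matrices: the  *)
(* inserted index i is recovered as the first row that is zero outside the    *)
(* last column.  Since alpha does not change the last column down to row i,   *)
(* where it is nonzero, rmin of the last column is preserved by theta, so the *)
(* rmax/rmin condition passes between A and D.                                *)

Require Import Defs.
From mathcomp Require Import all_boot all_algebra.
From mathcomp Require Import boolp classical_sets functions.
From mathcomp Require Import zify.

Set Implicit Arguments.
Unset Strict Implicit.
Unset Printing Implicit Defensive.

(** When [i < p], one step [alpha] opens a zero row and a zero column at index [i] and splits column
    [p.-1] of the leading block: its entries above row [i] go to column [i], the others slide one
    row down into column [p], below row [i], where the last column had only zeros. No entry is lost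
    or overwritten, so the weight is kept ([weight_alpha_fun]), and for known [i] the step is undone
    by [beta_fun] ([beta_alpha_fun], [alpha_beta_fun]). The index is visible in the image as its
    first row that is zero off the last column ([alpha_fun_thin], [first_thin_row_unique]). The
    rmax/rmin condition on the last two columns guarantees that the new column [i] is nonzero
    ([alpha_fun_fish]), and [beta_fun] restores this condition ([beta_fun_semifish]). The recursion
    [theta_mxS] lifts these facts to [theta_spec], [theta_inj] and [theta_surj]. *)

(** * Matrices as functions of natural number indices *)

Definition ent m (A : 'M[nat]_m) (r c : nat) : nat :=
  if insub r is Some i then if insub c is Some j then A i j else 0 else 0.

Lemma entE m (A : 'M[nat]_m) (i j : 'I_m) : ent A i j = A i j.
Proof. by rewrite /ent !valK. Qed.

Lemma ent_default m (A : 'M[nat]_m) r c : ~~ ((r < m) && (c < m)) -> ent A r c = 0.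
Proof.
rewrite /ent; case: insubP => [i -> _|_ _] //=.
by case: insubP => [j ->|].
Qed.

Lemma ent_gt0 m (A : 'M[nat]_m) r c : 0 < ent A r c -> (r < m) && (c < m).
Proof. by apply: contraLR => /(ent_default A) ->. Qed.

Lemma ent_inj m (A B : 'M[nat]_m) :
  (forall r c, r < m -> c < m -> ent A r c = ent B r c) -> A = B.
Proof. by move=> eqAB; apply/matrixP => i j; rewrite -!entE eqAB. Qed.

Definition mx_of m (f : nat -> nat -> nat) : 'M[nat]_m := \matrix_(i, j) f i j.

Lemma ent_mx_of m f r c : r < m -> c < m -> ent (mx_of m f) r c = f r c.
Proof.
by move=> rm cm; rewrite -[r]/(val (Ordinal rm)) -[c]/(val (Ordinal cm)) entE mxE.
Qed.

Lemma ent_leading m k (le_km : k <= m) (A : 'M[nat]_m) r c :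
  r < k -> c < k -> ent (leading_submx le_km A) r c = ent A r c.
Proof.
move=> rk ck; rewrite -[r]/(val (Ordinal rk)) -[c]/(val (Ordinal ck)) entE mxE.
by rewrite -entE.
Qed.

Lemma weightE m (A : 'M[nat]_m) : weight A = \sum_(r < m) \sum_(c < m) ent A r c.
Proof. by apply: eq_bigr => i _; apply: eq_bigr => j _; rewrite entE. Qed.

(* A matrix of dimension m is also viewed as a function on nat, whose values  *)
(* at indices >= m are irrelevant.                                            *)
Definition upper_fun m (f : nat -> nat -> nat) :=
  forall r c, c < r -> r < m -> f r c = 0.

Definition fish_fun m f := [/\ upper_fun m f,
  forall r, r < m -> exists2 c, c < m & 0 < f r c &
  forall c, c < m -> exists2 r, r < m & 0 < f r c].

(** For nonzero columns this is the rmax/rmin inequality, stated without extremal entries. *)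
Definition chained (f : nat -> nat -> nat) j :=
  exists r s, [/\ r < s, 0 < f r j & 0 < f s j.+1].

Definition fish_fun' m f := [/\ upper_fun m f,
  forall c, c < m -> exists2 r, r < m & 0 < f r c &
  forall j, j.+1 < m -> chained f j].

Lemma upper_ent m (A : 'M[nat]_m) : upper_triangular A <-> upper_fun m (ent A).
Proof.
split=> [utA r c cr rm | utA i j ji]; last by rewrite -entE utA.
have cm := ltn_trans cr rm.
by rewrite -[r]/(val (Ordinal rm)) -[c]/(val (Ordinal cm)) entE utA.
Qed.

Lemma no_zero_row_ent m (A : 'M[nat]_m) :
  no_zero_row A <-> forall r, r < m -> exists2 c, c < m & 0 < ent A r c.
Proof.
split=> [nzA r rm | nzA i].
  by have [j Aj] := nzA (Ordinal rm); exists j => //;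
    rewrite -[r]/(val (Ordinal rm)) entE.
have [c cm] := nzA i (ltn_ord i).
by rewrite -[c]/(val (Ordinal cm)) entE; exists (Ordinal cm).
Qed.

Lemma no_zero_column_ent m (A : 'M[nat]_m) :
  no_zero_column A <-> forall c, c < m -> exists2 r, r < m & 0 < ent A r c.
Proof.
split=> [nzA c cm | nzA j].
  by have [i Ai] := nzA (Ordinal cm); exists i => //;
    rewrite -[c]/(val (Ordinal cm)) entE.
have [r rm] := nzA j (ltn_ord j).
by rewrite -[r]/(val (Ordinal rm)) entE; exists (Ordinal rm).
Qed.

Lemma fishburn_ent m (A : 'M[nat]_m) : fishburn A <-> fish_fun m (ent A).
Proof.
rewrite /fishburn /fish_fun.
by split=> -[/upper_ent ? /no_zero_row_ent ? /no_zero_column_ent ?].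
Qed.

(** The default index [j] of [rmax] need not be a nonzero position, so the search itself must be
    shown to succeed; [arg_maxnP] with default [i0] supplies a maximum. *)
Lemma arg_max_gt0 m (A : 'M[nat]_m) j : (exists i, 0 < A i j) ->
  0 < A (rmax A j) j /\ forall i, 0 < A i j -> i <= rmax A j.
Proof.
case=> i0 Ai0; rewrite /rmax /arg_max /extremum.
case: pickP => [i /andP[Ai /forallP maxi] | no_max] /=.
  by split=> // k Ak; apply: (implyP (maxi k)).
case: (@arg_maxnP _ i0 (fun i => 0 < A i j) (fun i => i : nat) Ai0) => i Ai maxi.
have /= := no_max i; rewrite Ai /= => /negbT/forallPn[k].
by rewrite negb_imply => /andP[/maxi]; rewrite /= => ->.
Qed.

Lemma arg_min_gt0 m (A : 'M[nat]_m) j : (exists i, 0 < A i j) ->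
  0 < A (rmin A j) j /\ forall i, 0 < A i j -> rmin A j <= i.
Proof.
case=> i0 Ai0; rewrite /rmin /arg_min /extremum.
case: pickP => [i /andP[Ai /forallP maxi] | no_max] /=.
  by split=> // k Ak; apply: (implyP (maxi k)).
case: (@arg_minnP _ i0 (fun i => 0 < A i j) (fun i => i : nat) Ai0) => i Ai maxi.
have /= := no_max i; rewrite Ai /= => /negbT/forallPn[k].
by rewrite negb_imply => /andP[/maxi ->].
Qed.

Lemma fishburn'_ent m (A : 'M[nat]_m) : fishburn' A <-> fish_fun' m (ent A).
Proof.
split=> [[/upper_ent utA nzA chA] | [/upper_ent utA /no_zero_column_ent nzA chA]].
  split=> [//||j jm]; first exact/no_zero_column_ent.
  pose a := Ordinal (ltnW jm); pose b := Ordinal jm.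
  exists (rmin A a), (rmax A b).
  rewrite -[j.+1]/(val b) -[j]/(val a) !entE.
  by split; [apply: chA | case: (arg_min_gt0 (nzA a)) | case: (arg_max_gt0 (nzA b))].
split=> // j j' jj'.
have [|r [s [rs]]] := chA j; first by rewrite -jj'.
rewrite -jj' => Ar As.
have /andP[rm _] := ent_gt0 Ar; have /andP[sm _] := ent_gt0 As.
move: Ar As; rewrite -[r]/(val (Ordinal rm)) -[s]/(val (Ordinal sm)) !entE.
move=> /((arg_min_gt0 (nzA j)).2 _) /= Ar /((arg_max_gt0 (nzA j')).2 _) /= As.
exact: leq_ltn_trans Ar (leq_trans rs As).
Qed.

(** * One step and its inverse, on functions *)

(** Closed form of [alpha] in dimension [p.+1], with [i] the rmax of the last column; on upper
    triangular [f] the case [i = p] is the identity. *)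
Definition alpha_fun p i (f : nat -> nat -> nat) r c :=
  if c == p then if r <= i then f r p else f r.-1 p.-1
  else if c == i then if r < i then f r p.-1 else 0
  else if r == i then 0 else f (unbump i r) (unbump i c).

Definition beta_fun p i (g : nat -> nat -> nat) r c :=
  if i == p then g r c
  else if c == p then if r <= i then g r p else 0
  else if r == p then 0
  else if c == p.-1 then if r < i then g r i else g r.+1 p
  else g (bump i r) (bump i c).

(* The domain on which alpha is a bijection onto the Fishburn matrices; i is  *)
(* the index rmax of the last column.                                         *)
Definition semifish p i f := [/\ upper_fun p.+1 f, fish_fun p f, i <= p,
  0 < f i p /\ (forall r, i < r -> r <= p -> f r p = 0) &
  0 < p -> exists2 r, r < i & 0 < f r p.-1].

(** Characterizes the inserted row from the image alone. *)
Definition first_thin_row p i (g : nat -> nat -> nat) := [/\ i <= p,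
  forall c, c < p -> g i c = 0 &
  forall r, r < i -> exists2 c, c < p & 0 < g r c].

Lemma first_thin_row_unique p i i' g g' :
    (forall r c, r <= p -> c <= p -> g r c = g' r c) ->
  first_thin_row p i g -> first_thin_row p i' g' -> i = i'.
Proof.
move=> eqg [ip z1 nz1] [ip' z2 nz2].
case: (ltngtP i i') => // [/nz2|/nz1] [c cp].
  by rewrite -eqg ?z1 // ltnW.
by rewrite eqg ?z2 // ltnW.
Qed.

(** By triangularity row [p] vanishes off the last column, so a least such row exists. *)
Lemma first_thin_row_exists p g : fish_fun p.+1 g -> exists i, first_thin_row p i g.
Proof.
case=> ut rows _.
have thin_p : [forall c : 'I_p, g p c == 0].
  by apply/forallP => c; rewrite ut.
have exP : exists i, [forall c : 'I_p, g i c == 0] by exists p.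
case: (ex_minnP exP) => i /forallP thin_i min_i; exists i; split.
- exact: min_i.
- by move=> c cp; apply/eqP/(thin_i (Ordinal cp)).
- move=> r ri; have : ~~ [forall c : 'I_p, g r c == 0].
    by apply: contraL ri => /min_i; rewrite -leqNgt.
  by case/forallPn => c; rewrite -lt0n; exists c.
Qed.

Lemma alpha_beta_fun p i g : upper_fun p.+1 g -> first_thin_row p i g ->
  forall r c, r <= p -> c <= p -> alpha_fun p i (beta_fun p i g) r c = g r c.
Proof.
move=> ut [ip thin _] r c rp cp; rewrite /alpha_fun /beta_fun /bump /unbump.
(* The composite can differ from [g] only where [alpha_fun] or [beta_fun] writes a zero; [z1], [z2]
   and [z3] say that [g] vanishes there too. *)
have z1 : c = i -> i < p -> i <= r -> g r c = 0.
  move=> -> ip1; rewrite leq_eqVlt => /orP[/eqP<-|]; [exact: thin|by move/ut->].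
have z2 : r = i -> c < p -> g r c = 0 by move=> ->; apply: thin.
have z3 : c < r -> g r c = 0 by move/ut->.
repeat (case: ifP => ?; try lia); try (by rewrite z1 //; lia);
  try (by rewrite z2 //; lia); try (by rewrite z3 //; lia); congr g; lia.
Qed.

Lemma beta_alpha_fun p i f : semifish p i f ->
  forall r c, r <= p -> c <= p -> beta_fun p i (alpha_fun p i f) r c = f r c.
Proof.
move=> [ut _ ip [_ vz] _] r c rp cp; rewrite /alpha_fun /beta_fun /bump /unbump.
have z1 : c = p -> i < r -> f r c = 0 by move=> -> /vz->.
have z3 : c < r -> f r c = 0 by move/ut->.
repeat (case: ifP => ?; try lia); try (by rewrite z1 //; lia);
  try (by rewrite z3 //; lia); congr f; lia.
Qed.

Lemma alpha_fun_thin p i f : semifish p i f -> first_thin_row p i (alpha_fun p i f).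
Proof.
move=> [ut [_ rows _] ip _ link]; split=> // [c cp|r ri].
  by rewrite /alpha_fun ltnn eqxx ltn_eqF // if_same.
have [c cp fc] := rows r (leq_trans ri ip).
have [ip'|nip] := eqVneq i p.
  exists c => //; move: fc; rewrite /alpha_fun /unbump.
  by repeat (case: ifP => ?; try lia); congr (0 < f _ _); lia.
(* An entry in column [p.-1] above row [i] has been copied to column [i], which is still left of the
   last column. *)
have [cE|ncp] := eqVneq c p.-1.
  exists i; first lia; move: fc; rewrite /alpha_fun /unbump cE.
  by repeat (case: ifP => ?; try lia).
exists (bump i c); first (rewrite /bump; lia).
move: fc; rewrite /alpha_fun /unbump /bump.
by repeat (case: ifP => ?; try lia); congr (0 < f _ _); lia.
Qed.
Lemma eq_fish_fun m f g : (forall r c, r < m -> c < m -> f r c = g r c) ->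
  fish_fun m f -> fish_fun m g.
Proof.
move=> eqfg [ut rows cols]; split.
- by move=> r c cr rm; rewrite -eqfg ?ut // (ltn_trans cr).
- by move=> r rm; have [c cm ?] := rows r rm; exists c; rewrite -?eqfg.
- by move=> c cm; have [r rm ?] := cols c cm; exists r; rewrite -?eqfg.
Qed.

Lemma alpha_fun_fish p i f : semifish p i f -> fish_fun p.+1 (alpha_fun p i f).
Proof.
move=> sf; have [_ thin nthin] := alpha_fun_thin sf.
case: sf => ut [utp rows cols] ip [vi vz] link.
have gip : 0 < alpha_fun p i f i p by rewrite /alpha_fun eqxx leqnn.
split.
- move=> r c cr rp; rewrite /alpha_fun /unbump.
  have z1 : i = p -> f (r - (i < r)) (c - (i < c)) = 0.
    move=> ip'; apply: ut; lia.
  repeat (case: ifP => ?; try lia); apply: ut; lia.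
- move=> r; rewrite ltnS => rp; have [ri|ir|->] := ltngtP r i; last by exists p.
    by have [c cp ?] := nthin r ri; exists c => //; rewrite ltnS ltnW.
  have [|c cp fc] := rows r.-1; first lia.
  have [cE|ncp] := eqVneq c p.-1.
    by exists p => //; rewrite /alpha_fun eqxx (leqNgt r i) ir -cE.
  exists (bump i c); first (rewrite /bump; lia).
  move: fc; rewrite /alpha_fun /unbump /bump.
  by repeat (case: ifP => ?; try lia); congr (0 < f _ _); lia.
- move=> c; rewrite ltnS => cp.
  have [->|ncp] := eqVneq c p; first by exists i.
  (* The inserted column is nonzero thanks to [link], which puts an entry of column [p.-1] above row
     [i]. *)
  have [ci|nci] := eqVneq c i.
    have [|r ri fr] := link; first lia.
    exists r; first lia; rewrite /alpha_fun ci eqxx ri.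
    by case: ifP => // /eqP ipE; lia.
  have [|r rp fr] := cols (unbump i c); first (rewrite /unbump; lia).
  exists (bump i r); first (rewrite /bump; lia).
  move: fr; rewrite /alpha_fun /unbump /bump.
  by repeat (case: ifP => ?; try lia); congr (0 < f _ _); lia.
Qed.

Lemma beta_fun_semifish p i g : fish_fun p.+1 g -> first_thin_row p i g ->
  semifish p i (beta_fun p i g).
Proof.
move=> [ut rows cols] [ip thin nthin].
have gip : 0 < g i p.
  have [|c cp gc] := rows i; first by rewrite ltnS.
  have [cp'|cp'] := ltnP c p; first by rewrite thin in gc.
  by have <- : c = p by lia.
have colP c : c < p -> exists r, [/\ r <= c, r != i & 0 < g r c].
  move=> cp; have [|r rp gr] := cols c; first by rewrite ltnS ltnW.
  exists r; split=> //.
    by rewrite leqNgt; apply/negP => cr; rewrite ut in gr.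
  by apply/eqP => ri; rewrite ri thin in gr.
have link : 0 < p -> exists2 r, r < i & 0 < beta_fun p i g r p.-1.
  (* For [i < p], the part of the restored column [p.-1] above row [i] is that of column [i] of [g];
     since row [i] is thin, [r <= i] improves to [r < i]. *)
  move=> p0; have [|r [ri nri gr]] := colP (if i == p then p.-1 else i).
    by case: ifP; lia.
  exists r; first by move: ri; case: ifP; lia.
  move: gr ri nri; rewrite /beta_fun.
  by repeat (case: ifP => ?; try lia).
have utb : upper_fun p.+1 (beta_fun p i g).
  move=> r c cr rp; rewrite /beta_fun /bump.
  by repeat (case: ifP => ?; try lia); apply: ut; lia.
split=> //; last 1 first.
- rewrite /beta_fun eqxx leqnn if_same; split=> // r ir rp.
  by repeat (case: ifP => ?; try lia).
split; first by move=> r c cr rp; apply: utb => //; apply: ltnW.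
- move=> r rp; have [ri|ir] := ltnP r i.
    have [c cp gc] := nthin r ri; have [cE|nci] := eqVneq c i.
      exists p.-1; first lia; move: gc; rewrite cE /beta_fun.
      by repeat (case: ifP => ?; try lia).
    have [ip'|nip] := eqVneq i p; first by exists c => //; rewrite /beta_fun ip' eqxx.
    exists (unbump i c); first (rewrite /unbump; lia).
    move: gc; rewrite /beta_fun /unbump /bump.
    by repeat (case: ifP => ?; try lia); congr (0 < g _ _); lia.
  (* Row [r] with [i <= r] comes from row [r.+1] of [g], which by triangularity is zero in column
     [i]. *)
  have [|c cp gc] := rows r.+1; first lia.
  have nci : c != i.
    by apply/eqP => ci; rewrite ut // in gc; lia.
  have [cE|ncp] := eqVneq c p.
    exists p.-1; first lia; move: gc; rewrite cE /beta_fun.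
    by repeat (case: ifP => ?; try lia).
  exists (unbump i c); first (rewrite /unbump; lia).
  move: gc; rewrite /beta_fun /unbump /bump.
  by repeat (case: ifP => ?; try lia); congr (0 < g _ _); lia.
- move=> c cp; have [cE|ncE] := eqVneq c p.-1.
    have [|r ri ?] := link; first lia.
    by exists r; [lia | rewrite cE].
  have [ip'|nip] := eqVneq i p.
    have [//|r [rc _ gr]] := colP c.
    by exists r; [exact: leq_ltn_trans cp | rewrite /beta_fun ip' eqxx].
  have [|r [rc nri gr]] := colP (bump i c); first (rewrite /bump; lia).
  exists (unbump i r); first by move: rc; rewrite /unbump /bump; lia.
  move: gr rc; rewrite /beta_fun /unbump /bump.
  by repeat (case: ifP => ?; try lia); move=> gr _; move: gr; congr (0 < g _ _); lia.
Qed.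

(** Preservation of rmin of the last column, in threshold form: entries down to row [i] are
    unchanged, and any entry below is dominated by the nonzero one in row [i]. *)
Lemma alpha_fun_last p i f s : semifish p i f ->
  (exists r, [/\ r < s, r <= p & 0 < alpha_fun p i f r p]) <->
  (exists2 r, r < s & 0 < f r p).
Proof.
move=> [_ _ ip [vi vz] _]; rewrite /alpha_fun eqxx.
split=> [[r [rs rp]]|[r rs]].
  case: ifP => [_|ri _]; first by exists r.
  by exists i => //; lia.
have [ri fr|ir _] := leqP r i; last by exists i; rewrite leqnn; split=> //; lia.
by exists r; rewrite ri; split=> //; exact: leq_trans ip.
Qed.

Lemma sum_bump n i (F : nat -> nat) : i <= n ->
  \sum_(k < n.+1) F k = F i + \sum_(k < n) F (bump i k).
Proof. by rewrite -ltnS => ilt; rewrite (bigD1_ord (Ordinal ilt)). Qed.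

(** Columns [i] and [p] of the image together carry the entries of columns [p.-1] and [p] of [f];
    every other column only gains a zero in row [i] and loses its zero in row [p]. *)
Lemma weight_alpha_fun p i f : semifish p i f ->
  \sum_(r < p.+1) \sum_(c < p.+1) alpha_fun p i f r c
  = \sum_(r < p.+1) \sum_(c < p.+1) f r c.
Proof.
move=> [ut _ ip [_ vz] _].
have [ipE|nip] := eqVneq i p.
  apply: eq_bigr => r _; apply: eq_bigr => c _.
  have := ltn_ord r; have := ltn_ord c; rewrite !ltnS => cp rp.
  have [cr|rc] := ltnP c r.
    by rewrite (ut _ _ cr) // /alpha_fun ipE /unbump; repeat (case: ifP => ?; try lia);
      apply: ut; lia.
  by rewrite /alpha_fun ipE /unbump; repeat (case: ifP => ?; try lia);
    congr f; lia.
case: p => [|q] in ut ip vz nip *; first by lia.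
have {nip}iq : i <= q by lia.
rewrite exchange_big [RHS]exchange_big /=.
rewrite (sum_bump (i := i) (fun c => \sum_(r < q.+2) alpha_fun q.+1 i f r c)) //.
rewrite [\sum_(k < q.+1) _]big_ord_recr /= addnCA -big_split /=.
rewrite (sum_bump (i := i)
  (fun r => alpha_fun q.+1 i f r i + alpha_fun q.+1 i f r (bump i q))) //.
pose T c := \sum_(r < q.+2) f r c.
rewrite -[RHS]/(\sum_(c < q.+2) T c) [RHS]big_ord_recr /=.
rewrite [\sum_(c < q.+1) T c]big_ord_recr /= -[RHS]addnA; congr (_ + _).
  apply: eq_bigr => c _; have cq := ltn_ord c.
  rewrite (sum_bump (i := i) (fun r => alpha_fun q.+1 i f r (bump i c))) //.
  rewrite /T [RHS]big_ord_recr /= addnC; congr (_ + _).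
    apply: eq_bigr => r _; have rq := ltn_ord r.
    rewrite /alpha_fun /unbump /bump.
    by repeat (case: ifP => ?; try lia); congr f; lia.
  rewrite ut //; last lia.
  by rewrite /alpha_fun /unbump /bump; repeat (case: ifP => ?; try lia).
rewrite {1}/T [X in _ = X + _]big_ord_recr /= (ut q.+1 q) // addn0.
rewrite /T (sum_bump (i := i) (f^~ q.+1)) // [RHS]addnCA -big_split /=; congr (_ + _).
  by rewrite /alpha_fun /bump; repeat (case: ifP => ?; try lia).
apply: eq_bigr => r _; have rq := ltn_ord r; rewrite /alpha_fun.
have -> : bump i q = q.+1 by rewrite /bump; lia.
rewrite eqxx; have [ri|ir] := ltnP r i.
  have -> : bump i r = r by rewrite /bump; lia.
  by repeat (case: ifP => ?; try lia).
have -> : bump i r = r.+1 by rewrite /bump; lia.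
rewrite (vz r.+1) //=.
by repeat (case: ifP => ?; try lia).
Qed.

(** * From functions back to matrices, and the recursion for theta *)

(** When [i = p], [alpha] leaves [D] alone while [alpha_fun] clears row [p] off the diagonal;
    triangularity reconciles the two. *)
Lemma ent_alpha p (D : 'M[nat]_p.+1) r c : upper_triangular D -> r <= p -> c <= p ->
  ent (alpha D) r c = alpha_fun p (rmax D ord_max) (ent D) r c.
Proof.
move=> utD; rewrite -(ltnS r) -(ltnS c) => rp cp.
rewrite -[r]/(val (Ordinal rp)) -[c]/(val (Ordinal cp)) entE.
move: (Ordinal rp) (Ordinal cp) => {rp cp} {}r {}c.
have := leq_ord r; have := leq_ord c.
have utE : upper_fun p.+1 (ent D) by apply/upper_ent.
rewrite /alpha /alpha_fun; set i := rmax D ord_max; have ip := leq_ord i.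
case: ifPn => [/eqP -> /= cp rp|].
  case: ifP => [/eqP cE|ncp].
    by rewrite rp -[X in ent D r X]cE entE.
  rewrite -entE; have [cr|rc] := ltnP c r.
    rewrite utE //; symmetry.
    by rewrite /unbump; repeat (case: ifP => ?; try lia); apply: utE; lia.
  by rewrite /unbump; repeat (case: ifP => ?; try lia); congr ent; lia.
rewrite -val_eqE /= => nip cp rp.
have insE (a b : 'I_p.+1) : insert_zero i (leading_submx (leqnSn p) D) a b =
    if (a == i) || (b == i) then 0 else ent D (unbump i a) (unbump i b).
  rewrite mxE; case: unliftP => [a' ->|->]; last by rewrite eqxx.
  case: unliftP => [b' ->|->]; last by rewrite eqxx orbT.
  rewrite !(eq_sym (lift _ _)) !(negPf (neq_lift _ _)) /= !bumpK.
  by rewrite -entE ent_leading.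
rewrite 2!mxE !insE -!val_eqE /= -!entE /=.
case: eqVneq => [cE|ncp].
  rewrite andbT; case: ifP => // /negbT; rewrite -ltnNge => ir.
  rewrite ltnNge (ltnW ir) /= cE.
  by repeat (case: ifP => ?; try lia); rewrite /unbump; congr ent; lia.
rewrite andbF.
case: (eqVneq (c : nat) i) => [cE|nci]; rewrite ?andbF ?andbT ?orbT ?orbF.
  by repeat (case: ifP => ?; try lia); rewrite /unbump; congr ent; lia.
by case: ifP.
Qed.

Definition glue_mx p (B : 'M[nat]_p) (A : 'M[nat]_p.+1) : 'M[nat]_p.+1 :=
  mx_of p.+1 (fun r c => if (r < p) && (c < p) then ent B r c else ent A r c).

Lemma ent_glue p (B : 'M[nat]_p) (A : 'M[nat]_p.+1) r c :
  ent (glue_mx B A) r c = if (r < p) && (c < p) then ent B r c else ent A r c.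
Proof.
have [/andP[rp cp]|out] := boolP ((r < p.+1) && (c < p.+1)); first exact: ent_mx_of.
rewrite !(ent_default _ out); case: ifP => // /andP[rp cp].
by rewrite !ltnS (ltnW rp) (ltnW cp) in out.
Qed.

Lemma leading_glue p (B : 'M[nat]_p) (A : 'M[nat]_p.+1) :
  leading_submx (leqnSn p) (glue_mx B A) = B.
Proof. by apply: ent_inj => r c rp cp; rewrite ent_leading // ent_glue rp cp. Qed.

Lemma glue_leading p (A B : 'M[nat]_p.+1) :
  (forall r c, ~~ ((r < p) && (c < p)) -> ent A r c = ent B r c) ->
  glue_mx (leading_submx (leqnSn p) A) B = A.
Proof.
move=> eqAB; apply: ent_inj => r c _ _; rewrite ent_glue.
by case: ifPn => [/andP[rp cp]|/eqAB //]; rewrite ent_leading.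
Qed.

Lemma leading_alpha_at p (k : 'I_p) (A : 'M[nat]_p.+1) :
  leading_submx (leqnSn p) (alpha_at (widen_ord (leqnSn p) k) A)
  = alpha_at k (leading_submx (leqnSn p) A).
Proof.
apply/matrixP => r c; rewrite !mxE /=; case: ifP => // _.
congr (alpha _ _ _); apply/matrixP => i j; rewrite !mxE.
by congr (A _ _); apply: val_inj.
Qed.

Lemma alpha_at_outside p (k : 'I_p) (A : 'M[nat]_p.+1) r c :
  ~~ ((r < p) && (c < p)) ->
  ent (alpha_at (widen_ord (leqnSn p) k) A) r c = ent A r c.
Proof.
move=> out; have [/andP[rp cp]|o] := boolP ((r < p.+1) && (c < p.+1)); last first.
  by rewrite !(ent_default _ o).
rewrite -[r]/(val (Ordinal rp)) -[c]/(val (Ordinal cp)) !entE mxE /=.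
by case: ifP => // /andP[rk ck]; have := ltn_ord k; lia.
Qed.

Lemma alpha_at_max p (A : 'M[nat]_p.+1) : alpha_at ord_max A = alpha A.
Proof.
have lead_id : leading_submx (ltn_ord (@ord_max p)) A = A.
  by apply/matrixP => i j; rewrite mxE; congr (A _ _); apply: val_inj.
by apply/matrixP => r c; rewrite mxE !leq_ord /= lead_id !inord_val.
Qed.

(** All steps but the last act inside the leading block of dimension [p], where they compose to
    theta of that block. *)
Lemma theta_mxS p (A : 'M[nat]_p.+1) :
  theta_mx A = alpha (glue_mx (theta_mx (leading_submx (leqnSn p) A)) A).
Proof.
rewrite /theta_mx enum_ordSr -cats1 foldl_cat /= alpha_at_max; congr alpha.
(* The accumulator changes along the fold; the invariant is that it agrees with [A] outside the
   leading block. *)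
suff gen s B : (forall r c, ~~ ((r < p) && (c < p)) -> ent B r c = ent A r c) ->
    foldl (fun B k => alpha_at k B) B [seq widen_ord (leqnSn p) k | k <- s]
    = glue_mx (foldl (fun B k => alpha_at k B) (leading_submx (leqnSn p) B) s) A.
  exact: gen.
elim: s B => [|k s IH] B eqBA /=; first by rewrite glue_leading.
by rewrite IH ?leading_alpha_at // => r c out; rewrite alpha_at_outside ?eqBA.
Qed.
Definition column_rest p (A : 'M[nat]_p.+1) :=
  \sum_(r < p) ent A r p + \sum_(c < p.+1) ent A p c.

Lemma weight_glue p (B : 'M[nat]_p) (A : 'M[nat]_p.+1) :
  weight (glue_mx B A) = weight B + column_rest A.
Proof.
rewrite !weightE big_ord_recr /= /column_rest addnA -big_split /=; congr (_ + _).
  apply: eq_bigr => r _; rewrite big_ord_recr ent_glue /= ltnn andbF; congr (_ + _).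
  by apply: eq_bigr => c _; rewrite ent_glue !ltn_ord.
by apply: eq_bigr => c _; rewrite ent_glue ltnn.
Qed.

(** * Theta lands in Fishburn matrices *)

(** Equality of rmin in nonzero last columns, tested against all thresholds [s]; writing [c.+1 = m]
    makes it vacuous in dimension 0. *)
Definition same_last_rmin m (A B : 'M[nat]_m) := forall c s, c.+1 = m ->
  (exists2 r, r < s & 0 < ent A r c) <-> (exists2 r, r < s & 0 < ent B r c).

Lemma upper_fun_le m f r c : upper_fun m f -> r < m -> 0 < f r c -> r <= c.
Proof. by move=> ut rm; apply: contraTT; rewrite -ltnNge => /ut ->. Qed.

Lemma fishburn'_leading p (A : 'M[nat]_p.+1) :
  fishburn' A -> fishburn' (leading_submx (leqnSn p) A).
Proof.
move=> /fishburn'_ent [ut cols chA]; apply/fishburn'_ent.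
have le_of r c : 0 < ent A r c -> r <= c.
  by move=> Arc; have /andP[rp _] := ent_gt0 Arc; apply: (upper_fun_le ut).
split.
- move=> r c cr rp; rewrite ent_leading // ?(ltn_trans cr) //.
  by apply: ut => //; apply: ltnW.
- move=> c cp; have [r _ Arc] := cols c (ltnW cp).
  have rp := leq_ltn_trans (le_of _ _ Arc) cp.
  by exists r; rewrite ?ent_leading.
- move=> j jp; have [r [s [rs Ar As]]] := chA j (ltnW jp).
  exists r, s; rewrite !ent_leading //; try exact: ltnW.
    exact: leq_ltn_trans (le_of _ _ As) jp.
  exact: leq_ltn_trans (le_of _ _ Ar) (ltnW jp).
Qed.

Lemma semifish_glue p (B : 'M[nat]_p) (A : 'M[nat]_p.+1) :
    fishburn' A -> fishburn B -> same_last_rmin B (leading_submx (leqnSn p) A) ->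
  semifish p (rmax (glue_mx B A) ord_max) (ent (glue_mx B A)).
Proof.
move=> /fishburn'_ent [utA colsA chA] /fishburn_ent [utB rowsB colsB] lastBA.
have D_last r : ent (glue_mx B A) r p = ent A r p by rewrite ent_glue ltnn andbF.
have [|Di maxi] := @arg_max_gt0 _ (glue_mx B A) ord_max.
  have [r rp Ar] := colsA p (ltnSn p); exists (Ordinal rp).
  by rewrite -entE D_last.
set i := rmax _ _ in Di maxi *.
have {}maxi r : 0 < ent A r p -> r <= i.
  move=> Ar; have /andP[rp _] := ent_gt0 Ar.
  by apply: (maxi (Ordinal rp)); rewrite -entE D_last.
split; last 1 first.
- move=> p0; have [|r [s [rs Ar As]]] := chA p.-1; first by rewrite prednK.
  rewrite prednK // in As.
  have /andP[rp _] := ent_gt0 Ar; have rp1 := upper_fun_le utA rp Ar.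
  have [|r' r'i Br'] := (lastBA p.-1 i (prednK p0)).2.
    by exists r; [exact: leq_trans rs (maxi _ As) | rewrite ent_leading //; lia].
  have /andP[r'p p1p] := ent_gt0 Br'.
  by exists r'; rewrite // ent_glue r'p p1p.
- move=> r c cr rp; rewrite ent_glue; case: ifP => [/andP[rp' _]|_].
    exact: utB.
  exact: utA.
- apply: (@eq_fish_fun p (ent B)); last by [].
  by move=> r c rp cp; rewrite ent_glue rp cp.
- exact: leq_ord.
- split; first by rewrite -[p in ent _ _ p]/(val (@ord_max p)) entE.
  move=> r ir _; rewrite D_last; apply/eqP; rewrite -leqn0 leqNgt.
  by apply/negP => /maxi; rewrite leqNgt ir.
Qed.

Lemma semifish_alpha p (D : 'M[nat]_p.+1) :
  semifish p (rmax D ord_max) (ent D) -> forall r c, r < p.+1 -> c < p.+1 ->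
  alpha_fun p (rmax D ord_max) (ent D) r c = ent (alpha D) r c.
Proof. by move=> [ut _ _ _ _] r c rp cp; rewrite ent_alpha //; apply/upper_ent. Qed.

(** The claims are proved together: the next step of the induction needs the rmin claim to apply
    [semifish_glue]. *)
Lemma theta_spec m (A : 'M[nat]_m) : fishburn' A ->
  [/\ fishburn (theta_mx A), weight (theta_mx A) = weight A
    & same_last_rmin (theta_mx A) A].
Proof.
elim: m A => [|p IH] A fA.
  have -> : theta_mx A = A by apply/matrixP => -[].
  by split=> //; split=> -[].
have [fB wB lB] := IH _ (fishburn'_leading fA).
have sf := semifish_glue fA fB lB; have aE := semifish_alpha sf.
rewrite theta_mxS; set D := glue_mx _ A in sf aE *; split.
- exact/fishburn_ent/(eq_fish_fun aE)/alpha_fun_fish.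
- transitivity (weight D).
    rewrite !weightE -(weight_alpha_fun sf).
    by apply: eq_bigr => r _; apply: eq_bigr => c _; rewrite aE.
  by rewrite weight_glue wB -weight_glue glue_leading.
- move=> c s [->]; have [D_alpha alpha_D] := alpha_fun_last s sf.
  have D_last r : ent D r p = ent A r p by rewrite ent_glue ltnn andbF.
  split=> -[r rs Ar].
    have /andP[rp cp] := ent_gt0 Ar.
    have [|r' r's] := D_alpha; first by exists r; rewrite aE.
    by rewrite D_last; exists r'.
  have [|r' [r's r'p]] := alpha_D; first by exists r => //; rewrite D_last.
  by rewrite aE //; exists r'.
Qed.

(** * Injectivity of theta *)

Lemma eq_beta_fun p i g g' : i <= p ->
    (forall r c, r <= p -> c <= p -> g r c = g' r c) ->
  forall r c, r <= p -> c <= p -> beta_fun p i g r c = beta_fun p i g' r c.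
Proof.
move=> ip eqg r c rp cp; rewrite /beta_fun /bump.
by repeat (case: ifP => ?; try lia); apply: eqg; lia.
Qed.

Lemma alpha_inj p (D E : 'M[nat]_p.+1) :
    semifish p (rmax D ord_max) (ent D) -> semifish p (rmax E ord_max) (ent E) ->
  alpha D = alpha E -> D = E.
Proof.
move=> sD sE eqDE.
have aDE r c : r <= p -> c <= p -> alpha_fun p (rmax D ord_max) (ent D) r c
                       = alpha_fun p (rmax E ord_max) (ent E) r c.
  by move=> rp cp; rewrite !semifish_alpha // eqDE.
have iDE := first_thin_row_unique aDE (alpha_fun_thin sD) (alpha_fun_thin sE).
apply: ent_inj => r c rp cp.
rewrite -(beta_alpha_fun sD) // -(beta_alpha_fun sE) // -iDE.
by apply: eq_beta_fun => //; [exact: leq_ord | move=> ? ? ? ?; rewrite aDE // iDE].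
Qed.

Lemma theta_inj m (A B : 'M[nat]_m) : fishburn' A -> fishburn' B ->
  theta_mx A = theta_mx B -> A = B.
Proof.
elim: m A B => [|p IH] A B fA fB; first by move=> _; apply/matrixP => -[].
have [fA' _ lA] := theta_spec (fishburn'_leading fA).
have [fB' _ lB] := theta_spec (fishburn'_leading fB).
rewrite !theta_mxS => /alpha_inj eqD.
have {}eqD := eqD (semifish_glue fA fA' lA) (semifish_glue fB fB' lB).
have /(IH _ _ (fishburn'_leading fA) (fishburn'_leading fB)) eqL :
    theta_mx (leading_submx (leqnSn p) A) = theta_mx (leading_submx (leqnSn p) B).
  by rewrite -[LHS](leading_glue _ A) eqD leading_glue.
rewrite -[A](@glue_leading _ A A) // eqL; apply: glue_leading => r c out.
have := congr1 (fun D => ent D r c) eqD.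
by rewrite !ent_glue (negPf out).
Qed.

(** * Surjectivity of theta, and the bijection *)

Lemma eq_alpha_fun p i f f' : i <= p ->
    (forall r c, r <= p -> c <= p -> f r c = f' r c) ->
  forall r c, r <= p -> c <= p -> alpha_fun p i f r c = alpha_fun p i f' r c.
Proof.
move=> ip eqf r c rp cp; rewrite /alpha_fun /unbump.
by repeat (case: ifP => ?; try lia); apply: eqf; lia.
Qed.

Lemma eq_semifish p i f f' : (forall r c, r <= p -> c <= p -> f r c = f' r c) ->
  semifish p i f -> semifish p i f'.
Proof.
move=> eqf [ut fish ip [vi vz] link]; split=> //.
- by move=> r c cr rp; rewrite -eqf ?ut //; lia.
- by apply: eq_fish_fun fish => r c rp cp; apply: eqf; apply: ltnW.
- by split; [rewrite -eqf | move=> r ir rp; rewrite -eqf ?vz].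
- move=> p0; have [r ri fr] := link p0; exists r => //.
  by rewrite -eqf //; lia.
Qed.

Lemma rmax_semifish p i (D : 'M[nat]_p.+1) :
  semifish p i (ent D) -> rmax D ord_max = i :> nat.
Proof.
move=> [_ _ ip [Di Dz] _]; rewrite -ltnS in ip.
have [|Dr maxr] := @arg_max_gt0 _ D ord_max.
  by exists (Ordinal ip); rewrite -entE.
apply/eqP; rewrite eqn_leq; apply/andP; split.
  rewrite leqNgt; apply/negP => ir; move: Dr; rewrite -entE /= Dz //.
  exact: leq_ord.
by apply: (maxr (Ordinal ip)); rewrite -entE.
Qed.

(** Converse of [semifish_glue]: the leading block is replaced by its preimage, and rmin
    preservation carries the condition on the last two columns back. *)
Lemma fishburn'_glue p (A : 'M[nat]_p) (D : 'M[nat]_p.+1) i :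
    fishburn' A -> theta_mx A = leading_submx (leqnSn p) D ->
  semifish p i (ent D) -> fishburn' (glue_mx A D).
Proof.
move=> fA thA [utD _ ip [Di _] link].
have [_ _ lastA] := theta_spec fA.
case/fishburn'_ent: fA => utA colsA chA; apply/fishburn'_ent.
have inA r c : 0 < ent A r c -> 0 < ent (glue_mx A D) r c.
  by move=> Arc; rewrite ent_glue (ent_gt0 Arc).
have Dip : 0 < ent (glue_mx A D) i p by rewrite ent_glue ltnn andbF.
split.
- move=> r c cr rp; rewrite ent_glue; case: ifP => [/andP[rp' _]|_].
    exact: utA.
  exact: utD.
- move=> c; rewrite ltnS leq_eqVlt => /orP[/eqP->|cp]; first by exists i.
  by have [r rp Arc] := colsA c cp; exists r; [exact: ltnW | exact: inA].
- move=> j; rewrite ltnS leq_eqVlt => /orP[/eqP jp|/chA[r [s [rs Ar As]]]]; last first.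
    by exists r, s; split=> //; apply: inA.
  have [|r ri Dr] := link; first by rewrite -jp.
  have [|r' r'i Ar'] := (lastA j i jp).1.
    exists r => //; rewrite thA ent_leading ?(leq_trans ri ip) -?jp //.
    by rewrite (_ : j = p.-1) // -jp.
  by exists r', i; rewrite jp; split=> //; apply: inA.
Qed.

(** Undo the last step with [beta_fun] at the first thin row, pull the leading block back by
    induction, and keep the rest of [D]. *)
Lemma theta_surj m (C : 'M[nat]_m) : fishburn C ->
  exists2 A, fishburn' A & theta_mx A = C.
Proof.
elim: m C => [|p IH] C.
  by move=> _; exists C; [split=> -[] | apply/matrixP => -[]].
move=> /fishburn_ent fC; have [i thin] := first_thin_row_exists fC.
pose D := mx_of p.+1 (beta_fun p i (ent C)).
have entD r c : r <= p -> c <= p -> beta_fun p i (ent C) r c = ent D r c.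
  by move=> rp cp; rewrite ent_mx_of.
have sf := eq_semifish entD (beta_fun_semifish fC thin).
have [|A fA thA] := IH (leading_submx (leqnSn p) D).
  apply/fishburn_ent; case: (sf) => _ fish _ _ _; apply: eq_fish_fun fish.
  by move=> r c rp cp; rewrite ent_leading.
exists (glue_mx A D); first exact: fishburn'_glue sf.
rewrite theta_mxS leading_glue thA (_ : glue_mx _ _ = D); last first.
  by apply: glue_leading => r c out; rewrite ent_glue (negPf out).
case: (thin) (fC) (sf) => ip _ _ [utC _ _] [utD _ _ _ _].
apply: ent_inj => r c rp cp.
rewrite ent_alpha ?(rmax_semifish sf) //; last exact/upper_ent.
by rewrite -(eq_alpha_fun ip entD) // alpha_beta_fun.
Qed.

Theorem theorem4p8 (n : nat) (hn : (1 <= n)%N) :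
  set_bij (Mset' n) (Mset n) theta.
Proof.
split.
- by move=> [m A] [/= fA <-]; have [fB wB _] := theta_spec fA.
- move=> [m A] [m' B] /set_mem[/= fA _] /set_mem[/= fB _] eqAB.
  have mm' : m = m' := congr1 (@projT1 _ _) eqAB.
  (* Identifying the dimensions lets the equality of dependent pairs yield one of matrices. *)
  case: m' / mm' in B fB eqAB *.
  by rewrite (theta_inj fA fB (existT_inj2 eqAB)).
- move=> [m C] [/= fC wC]; have [A fA thA] := theta_surj fC.
  have [_ wA _] := theta_spec fA.
  exists (existT (fun m => 'M[nat]_m) m A); last by rewrite /theta /= thA.
  by split=> //=; rewrite -wA thA.
Qed.
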